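(* Let $f_{\mathrm{sw}}^s$ be the solution of the semi-discrete Vlasov-Poisson equations in the symmetrically weighted (SW) formulation, as given in the context. Then the number of particles $\mathcal{N}^s(t)=\int_0^\ell\int_{\mathbb{R}}f_{\mathrm{sw}}^s(x,v,t)\,\mathrm{d}v\,\mathrm{d}x$ of each plasma species $s$ is conserved in time if $N_v$ is odd, and its drift rate is $$\frac{\mathrm{d}\mathcal{N}^s}{\mathrm{d}t}=\begin{cases}0&\text{if }N_v\text{ is odd},\\[2pt]-\Delta x\,\dfrac{q^s}{m^s}\sqrt{\dfrac{N_v-1}{2}}\;\mathcal{I}_{N_v-2}\,\mathbf{E}(t)^\top\mathbf{C}^s_{N_v-1}(t)&\text{if }N_v\text{ is even}.\end{cases}$$
   Context: Finitely many species $s$ have constants $q^s,u^s\in\mathbb{R}$ and $m^s,\alpha^s>0$; $N_v\ge1$ is the number of velocity modes. The spatial domain $[0,\ell]$ is periodic, with a uniform grid $x^{(1)},\dots,x^{(N_x)}$, spacing $\Delta x=\ell/N_x$. Basis: $\psi_n(\xi)=(\sqrt\pi2^nn!)^{-1/2}\mathcal H_n(\xi)e^{-\xi^2/2}$ with physicists' Hermite polynomials $\mathcal H_n$, $\xi^s=(v-u^s)/\alpha^s$; $\mathcal{I}_n=\int_{\mathbb R}\psi_n(\xi)\,\mathrm d\xi$. $\mathbf{D}^p\in\mathbb{R}^{N_x\times N_x}$ is the periodic centered finite difference matrix of even order $p$ ($N_x>p$): the circulant matrix $\mathbf{D}^p_{jk}=d^p_{(k-j)\bmod N_x}$ with $d_0^p=0$;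 for $1\le k\le p/2=:r$, $d_k^p=\frac{1}{\Delta x}\frac{(-1)^{k+1}(r!)^2}{k(r-k)!(r+k)!}$ and $d_{N_x-k}^p=-d_k^p$; all other $d_k^p=0$. Semi-discrete SW system: differentiable functions $\mathbf{C}_n^s(t)\in\mathbb{R}^{N_x}$ ($0\le n\le N_v-1$; convention $\mathbf C_{-1}^s=\mathbf C_{N_v}^s=0$) and $\mathbf E(t)\in\mathbb{R}^{N_x}$ with $$\frac{\mathrm d\mathbf C_n^s}{\mathrm dt}=-\mathbf D^p\Big(\alpha^s\sqrt{\tfrac n2}\,\mathbf C_{n-1}^s+\alpha^s\sqrt{\tfrac{n+1}2}\,\mathbf C_{n+1}^s+u^s\mathbf C_n^s\Big)+\frac{q^s}{m^s\alpha^s}\mathbf E\odot\Big(\sqrt{\tfrac n2}\,\mathbf C_{n-1}^s-\sqrt{\tfrac{n+1}2}\,\mathbf C_{n+1}^s\Big),$$ $$\mathbf D^p\mathbf E(t)=\sum_sq^s\alpha^s\sum_{n=0}^{N_v-1}\mathcal I_n\mathbf C_n^s(t),\qquad \mathbf 1^\top\mathbf E(t)=0,$$ where $\odot$ is the entrywise product and $\mathbf 1$ the all-ones vector. The solution is $f^s_{\mathrm{sw}}(x^{(j)},v,t)=\sum_{n=0}^{N_v-1}(\mathbf C_n^s(t))_j\,\psi_n(\xi^s)$. All integrals over $x$ are evaluated by the periodic trapezoidal rule $\int_0^\ell g\,\mathrm dx:=\Delta x\sum_jg(x^{(j)})$, so $\mathcal N^s(t)=\Delta x\,\alpha^s\sum_{n=0}^{N_v-1}\mathcal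 I_n\mathbf 1^\top\mathbf C_n^s(t)$. *)

(* Defs.v *)
From HB Require Import structures.
From mathcomp Require Import all_boot all_order all_algebra.
From mathcomp Require Import ring lra.
From mathcomp Require Import all_classical all_reals all_analysis.

Set Implicit Arguments.
Unset Strict Implicit.
Unset Printing Implicit Defensive.

Import Order.TTheory GRing.Theory Num.Theory.
Import numFieldNormedType.Exports.

Local Open Scope classical_set_scope.
Local Open Scope ring_scope.

Section Hermite.
Variable R : realType.

(* Physicists' normalization; [hermite_Rodrigues] below is the usual formula. *)
Fixpoint hermite (n : nat) : {poly R} :=
  match n with
  | 0 => 1
  | n'.+1 => match n' with
             | 0 => 2%:P * 'X
             | n''.+1 => 2%:P * 'X * hermite n' - (2 * n'%:R)%:P * hermite n''
             end
  end.

Definition psi (n : nat) (xi : R) : R :=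
  (Num.sqrt (Num.sqrt pi * 2 ^+ n * n`!%:R))^-1
  * (hermite n).[xi] * expR (- xi ^+ 2 / 2).

Definition psi_int (n : nat) : R :=
  \int[@lebesgue_measure R]_xi psi n xi.

Lemma hermiteSS n : hermite n.+2 =
  2%:P * 'X * hermite n.+1 - (2 * n.+1%:R)%:P * hermite n.
Proof. by []. Qed.

Lemma deriv_hermiteS n : (hermite n.+1)^`() = (2 * n.+1%:R)%:P * hermite n.
Proof.
suff [//] : (hermite n.+1)^`() = (2 * n.+1%:R)%:P * hermite n /\
  (hermite n.+2)^`() = (2 * n.+2%:R)%:P * hermite n.+1.
have step k : (hermite k.+2)^`() = 2%:P * hermite k.+1
    + 2%:P * 'X * (hermite k.+1)^`() - (2 * k.+1%:R)%:P * (hermite k)^`().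
  rewrite hermiteSS derivB [in LHS](derivM _ (hermite k)) derivC mul0r add0r.
  rewrite [in LHS](derivM _ (hermite k.+1)) [in LHS](derivM 2%:P) derivC derivX.
  by rewrite mul0r add0r mulr1.
have d1 : (hermite 1)^`() = (2 * 1%:R)%:P * hermite 0.
  by rewrite /= derivM derivC mul0r add0r derivX !mulr1.
elim: n => [|n [IH1 IH2]]; split=> //.
  rewrite step d1 (_ : (hermite 0)^`() = 0) ?derivC// mulr0 subr0 /= !polyCM.
  by rewrite !polyC_natr; ring.
rewrite step IH1 IH2 (hermiteSS n) !polyCM !polyC_natr -!natr1.
by ring.
Qed.

Lemma hermite_Rodrigues n (x : R) :
  (hermite n).[x] = (-1) ^+ n * expR (x ^+ 2) *
    (fun y : R => expR (- y ^+ 2))^`(n)%classic x.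
Proof.
suff -> : (fun y : R => expR (- y ^+ 2))^`(n)%classic =
    fun y => (-1) ^+ n * (hermite n).[y] * expR (- y ^+ 2).
  have e1 : expR (x ^+ 2) * expR (- x ^+ 2) = 1 := expRxMexpNx_1 _.
  have s1 : (-1) ^+ n * (-1) ^+ n = 1 :> R by rewrite -expr2 sqrr_sign.
  by rewrite -[LHS]mulr1 -[LHS]mulr1 -{1}s1 -e1; ring.
have rec k : hermite k.+1 = 2%:P * 'X * hermite k - (hermite k)^`().
  case: k => [|k]; first by rewrite /= derivC mulr1 subr0.
  by rewrite deriv_hermiteS hermiteSS.
elim: n => [|n IH].
  by rewrite derive1n0; apply/funext => y; rewrite expr0 /= hornerC !mul1r.
rewrite derive1nS IH; apply/funext => y; rewrite derive1E.
have dg : is_derive y (1 : R) (fun z : R => - z ^+ 2) (- (2 * y)).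
  have h := is_deriveN (is_deriveX 2 (is_derive_id y (1 : R))).
  have E : (fun z : R => - z ^+ 2) = - (id ^+ 2) by apply/funext.
  by rewrite E; apply: (is_derive_eq h); rewrite /GRing.scale/= expr1 mulr1.
have de : is_derive y (1 : R) (fun z : R => expR (- z ^+ 2))
    (- (2 * y) * expR (- y ^+ 2)).
  have h := @is_derive1_comp _ expR _ _ _ _ (is_derive_expR _) dg.
  by apply: is_derive_eq h _; rewrite mulrC.
have dp := is_deriveM (is_derive_poly (hermite n) y) de.
have := is_deriveZ ((-1) ^+ n) dp => h.
rewrite (_ : (fun z => _) = ((-1) ^+ n) \*: ((horner (hermite n)) *
   (fun z : R => expR (- z ^+ 2)))); last first.
  by apply/funext => z /=; rewrite -mulrA.
rewrite derive_val rec !hornerE /GRing.scale/= [(-1) ^+ n.+1]exprS.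
by ring.
Qed.

End Hermite.

Section FiniteDifference.
Variables (R : realType) (Nx p : nat) (dx : R).

Definition fd_weight (k : nat) : R :=
  let r := p./2 in
  dx^-1 * ((-1) ^+ k.+1 * r`!%:R ^+ 2 / (k%:R * (r - k)`!%:R * (r + k)`!%:R)).

(* [fd_coef 0 = 0]; for [p < Nx] the two nonzero ranges are disjoint. *)
Definition fd_coef (k : nat) : R :=
  if (0 < k <= p./2)%N then fd_weight k
  else if (Nx - p./2 <= k < Nx)%N then - fd_weight (Nx - k)
  else 0.

(* [k + Nx - j] is [k - j] modulo [Nx], without natural-number truncation. *)
Definition fd_mx : 'M[R]_Nx :=
  \matrix_(j, k) fd_coef ((k + Nx - j) %% Nx)%N.

End FiniteDifference.

Section SWSystem.
Variables (R : realType) (S : finType) (Nv Nx p : nat) (ell : R).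
Variables q u m alpha : S -> R.
Variable C : S -> 'I_Nv -> R -> 'cV[R]_Nx.
Variable E : R -> 'cV[R]_Nx.

Definition spacing : R := ell / Nx%:R.

(* Extension of the coefficients to integer indices by zero, which encodes
   the closure C_{-1} = C_{Nv} = 0. *)
Definition coef (s : S) (n : int) (t : R) : 'cV[R]_Nx :=
  if n is Posz k then (if insub k is Some i then C s i t else 0) else 0.

Definition hadamard (a b : 'cV[R]_Nx) : 'cV[R]_Nx := map2_mx *%R a b.

Definition sw_rhs (s : S) (n : nat) (t : R) : 'cV[R]_Nx :=
  let Dp := fd_mx Nx p spacing in
  - (Dp *m ((alpha s * Num.sqrt (n%:R / 2)) *: coef s (n%:Z - 1) t
            + (alpha s * Num.sqrt (n.+1%:R / 2)) *: coef s (n%:Z + 1) t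
            + u s *: coef s n t))
  + (q s / (m s * alpha s)) *:
      hadamard (E t) (Num.sqrt (n%:R / 2) *: coef s (n%:Z - 1) t
                      - Num.sqrt (n.+1%:R / 2) *: coef s (n%:Z + 1) t).

Record sw_solution (J : set R) : Prop := SWSolution {
  sw_vlasov : forall (s : S) (n : 'I_Nv) (t : R), J t ->
    is_derive t 1 (C s n) (sw_rhs s n t);
  sw_field_derivable : forall t : R, J t -> derivable E t 1;
  sw_poisson : forall t : R, J t ->
    fd_mx Nx p spacing *m E t =
    \sum_s (q s * alpha s) *: \sum_(n < Nv) psi_int R n *: C s n t;
  sw_zero_mean : forall t : R, J t -> \sum_j E t j 0 = 0
}.

(* Value at the [j]-th grid point, at velocity [v] and time [t]. *)
Definition f_sw (s : S) (j : 'I_Nx) (v t : R) : R :=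
  \sum_(n < Nv) C s n t j 0 * psi n ((v - u s) / alpha s).

(* The integral over space is the periodic trapezoidal rule on the grid. *)
Definition particle_number (s : S) (t : R) : R :=
  spacing * \sum_(j < Nx) \int[@lebesgue_measure R]_v f_sw s j v t.

End SWSystem.

(* Main.v *)
Require Import Defs.
From HB Require Import structures.
From mathcomp Require Import all_boot all_order all_algebra.
From mathcomp Require Import zify ring lra.
From mathcomp Require Import all_classical all_reals all_analysis.
From mathcomp Require Import measurable_realfun.

Set Implicit Arguments.
Unset Strict Implicit.
Unset Printing Implicit Defensive.

Import Order.TTheory GRing.Theory Num.Theory.
Import numFieldNormedType.Exports.

Local Open Scope classical_set_scope.
Local Open Scope ring_scope.

(** Integrating the ansatz in [v] turns the number of particles of a species
    into a fixed linear combination of the coefficient sums: each mode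
    contributes its sum over the grid, weighted by the integral of its Hermite
    function ([particle_numberE]).  So the drift rate is the same combination
    of the right-hand sides of the evolution equations, and two cancellations
    decide what remains.

    Transport contributes nothing: the stencil of a centered difference is
    antisymmetric, hence every column of the periodic difference matrix sums to
    zero ([fd_mx_col_sum]) and advection only redistributes mass on the grid.

    Acceleration shifts mass between neighbouring modes.  As
    [psi_n' = sqrt (n / 2) psi_(n-1) - sqrt ((n + 1) / 2) psi_(n+1)] has integral
    zero, the integrals obey the recurrence [psi_int_rec].  This is exactly the
    relation that makes the acceleration terms telescope
    ([telescope_three_term]), leaving only what the truncation at [Nv] cuts off:
    a multiple of the integral of the Hermite function of index [Nv - 2].  For
    odd [Nv] that index is odd and the integral vanishes ([psi_int_odd]), the
    case [Nv = 1] being covered by the vanishing factor [sqrt ((Nv - 1) / 2)].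

    The analytic input is integration by parts against the Gaussian weight
    [exp (- x ^ 2 / 2)] on the whole line, for polynomial integrands
    ([Rintegral_deriv_poly_gaussian]): the Hermite polynomials are related by
    [H_(k+1) = 2 X H_k - H_k'], so it yields the recurrence for their weighted
    integrals directly, with no appeal to parity. *)

Local Notation mu := (@lebesgue_measure _).

(** * Affine substitution on the real line *)

Lemma continuous_affine (R : realType) (a u : R) :
  continuous (fun x : R => (x - u) / a).
Proof.
by move=> x; apply: cvgM; [apply: cvgB; [exact: cvg_id|]|]; exact: cvg_cst.
Qed.

Lemma ge0_integral_affine (R : realType) (f : R -> R) (a u : R) :
  0 < a -> continuous f -> (forall x, 0 <= f x) ->
  (\int[mu]_x (f ((x - u) / a))%:E = a%:E * \int[mu]_x (f x)%:E)%E.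
Proof.
move=> a0 cf f0; have a'0 : 0 <= a^-1 by rewrite invr_ge0 ltW.
pose F (x : R^o) := (x - u) / a.
have F'E : F^`()%classic = cst a^-1.
  apply/funext => x; rewrite /F derive1E deriveM// deriveD// derive_cst scaler0.
  by rewrite add0r derive_id derive_cst addr0 scaler1.
have cF : continuous F.
  exact: continuous_affine.
have mfF : measurable_fun setT (fun x => f (F x)).
  apply: continuous_measurable_fun => x.
  by apply: continuous_comp; [exact: cF|exact: cf].
rewrite (@increasing_ge0_integration_by_substitutionT _ F f)//.
- rewrite muleC -ge0_integralZr//; first last.
  + by rewrite lee_fin ltW.
  + by move=> x _; rewrite lee_fin F'E; apply: mulr_ge0 => //; exact: f0.
  + by rewrite F'E; apply/measurable_EFinP/measurable_funM.
  by apply: eq_integral => x _; rewrite F'E -EFinM/= divfK// gt_eqF.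
- by move=> x y xy; rewrite /F ltr_pM2r ?invr_gt0// ltrD2r.
- by rewrite F'E => ?; exact: cvg_cst.
- by rewrite F'E; exact: is_cvg_cst.
- by rewrite F'E; exact: is_cvg_cst.
- by apply/gt0_cvgMlNy; [rewrite invr_gt0|exact: cvg_addrr_Ny].
- by apply/gt0_cvgMly; [rewrite invr_gt0|exact: cvg_addrr].
Qed.

(** Splitting into positive and negative parts reduces this to nonnegative
    integrands.  The recombination is valid even when both parts have infinite
    integral, because multiplication by a positive finite constant preserves the
    value given to [+oo - oo]. *)
Lemma integral_affine (R : realType) (f : R -> R) (a u : R) :
  0 < a -> continuous f ->
  (\int[mu]_x (f ((x - u) / a))%:E = a%:E * \int[mu]_x (f x)%:E)%E.
Proof.
move=> a0 cf.
have posE (g : R -> R) :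
    (\int[mu]_x (fun y => (g y)%:E)^\+ x = \int[mu]_x (Num.max (g x) 0)%:E)%E.
  by apply: eq_integral => x _; rewrite funeposE EFin_max.
have negE (g : R -> R) :
    (\int[mu]_x (fun y => (g y)%:E)^\- x = \int[mu]_x (Num.max (- g x) 0)%:E)%E.
  by apply: eq_integral => x _; rewrite funenegE EFin_max EFinN.
have cmax (g : R -> R) : continuous g -> continuous (fun x => Num.max (g x) 0).
  by move=> cg x; apply: (@continuous_max _ _ g (cst 0));
    [exact: cg|exact: cst_continuous].
rewrite integralE [in RHS]integralE !posE !negE.
rewrite (@ge0_integral_affine R (fun x => Num.max (f x) 0))//; last 2 first.
- exact: cmax.
- by move=> x; rewrite le_max lexx orbT.
rewrite (@ge0_integral_affine R (fun x => Num.max (- f x) 0))//; last 2 first.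
- by apply: cmax => x; apply: continuousN; exact: cf.
- by move=> x; rewrite le_max lexx orbT.
have a0e : (0 < a%:E)%E by rewrite lte_fin.
move: (integral _ _ _) (integral _ _ _) => [x||] [y||] //=;
  rewrite ?(gt0_muley, gt0_muleNy)// -?EFinM -?EFinB ?mulrBr//=.
Qed.

Lemma integrable_affine (R : realType) (f : R -> R) (a u : R) :
  0 < a -> continuous f -> mu.-integrable setT (EFin \o f) ->
  mu.-integrable setT (fun x => (f ((x - u) / a))%:E).
Proof.
move=> a0 cf /integrableP[_ foo]; apply/integrableP; split.
  apply/measurable_EFinP; apply: (@continuous_measurable_fun R) => x.
  apply: (@continuous_comp _ _ _ (fun x => (x - u) / a) f); last exact: cf.
  exact: continuous_affine.
rewrite (@integral_affine R (fun x => `|f x|) a u a0); last first.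
  by move=> x; apply: continuous_comp; [exact: cf|exact: norm_continuous].
by rewrite lte_mul_pinfty// lee_fin ltW.
Qed.

(** * Polynomials against the Gaussian weight *)

Definition gaussian {R : realType} (x : R) := expR (- x ^+ 2 / 2).

(** Reduces facts on the weight of the Hermite functions to those on the
    Gaussian [exp (- x ^ 2)]. *)
Lemma gaussianE (R : realType) : @gaussian R = fun x => gauss_fun (x / Num.sqrt 2).
Proof.
apply/funext => x; rewrite /gaussian /gauss_fun exprMn exprVn sqr_sqrtr//.
by rewrite mulNr.
Qed.

Lemma poly_growth (R : realType) (p : {poly R}) : exists K n, 0 <= K /\
  forall x, `|p.[x]| <= K * (1 + x ^+ 2) ^+ n.
Proof.
elim/poly_ind: p => [|p c [K [n [K0 pK]]]].
  by exists 0, 0%N; split=> // x; rewrite horner0 normr0 mul0r.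
exists (K + `|c|), n.+1; split=> [|x]; first by rewrite addr_ge0.
have x1 : 1 <= 1 + x ^+ 2 by rewrite lerDl sqr_ge0.
rewrite hornerMXaddC (le_trans (ler_normD _ _))// normrM mulrDl lerD//.
  rewrite exprSr mulrA ler_pM// -(real_normK (num_real x)).
  by have := sqr_ge0 (`|x| - 1); have := normr_ge0 x; nra.
by rewrite ler_peMr// exprn_ege1.
Qed.

(** Half of the exponent absorbs the polynomial: for [y = (1 + x ^ 2) / 4], the
    power series of the exponential bounds [y ^ n / n!] by [exp y], so a power of
    [1 + x ^ 2] is at most a constant times [exp (x ^ 2 / 4)].  The other half
    of the exponent, [- x ^ 2 / 4], is what [gauss_fun (x / 2)] stands for. *)
Lemma poly_gaussian_bound (R : realType) (p : {poly R}) : exists2 K, 0 <= K &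
  forall x, `|p.[x] * gaussian x| <= K * gauss_fun (x / 2).
Proof.
have [K [n [K0 pK]]] := poly_growth p.
exists (K * (4 ^+ n.+1 * n.+1`!%:R * expR (1 / 4))) => [|x].
  by rewrite !mulr_ge0// expR_ge0.
have x0 : 0 <= (1 + x ^+ 2) / 4 by rewrite divr_ge0// addr_ge0// sqr_ge0.
rewrite normrM (ger0_norm (expR_ge0 _)) -mulrA.
rewrite (le_trans (ler_wpM2r (expR_ge0 _) (pK x)))//.
rewrite -[leLHS]mulrA ler_wpM2l//.
rewrite /gaussian /gauss_fun.
have -> : - x ^+ 2 / 2 = - (x ^+ 2 / 4) - (x ^+ 2 / 4) :> R by field.
have -> : - (x / 2) ^+ 2 = - (x ^+ 2 / 4) :> R by field.
rewrite expRD mulrA ler_wpM2r ?expR_ge0// expRN ler_pdivrMr ?expR_gt0//.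
rewrite -(mulrA _ (expR _)) -expRD -mulrDl.
have := expR_ge1Dxn n x0; set e := expR _ => xe.
have : ((1 + x ^+ 2) / 4) ^+ n.+1 / n.+1`!%:R <= e.
  by apply: le_trans xe; rewrite lerDr.
rewrite ler_pdivrMr ?ltr0n ?fact_gt0// expr_div_n ler_pdivrMr ?exprn_gt0// => le.
apply: (le_trans (y := (1 + x ^+ 2) ^+ n.+1)).
  by rewrite [leRHS]exprS ler_peMl ?exprn_ge0 ?lerDl ?addr_ge0 ?sqr_ge0.
by rewrite mulrC (mulrC _ n.+1`!%:R) mulrA.
Qed.

Lemma continuous_poly_gaussian (R : realType) (p : {poly R}) :
  continuous (fun x => p.[x] * gaussian x).
Proof.
move=> x; apply: cvgM; first exact: continuous_horner.
rewrite gaussianE; apply: (@continuous_comp _ _ _ (fun x : R => x / Num.sqrt 2)).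
  by apply: cvgM; [exact: cvg_id|exact: cvg_cst].
exact: continuous_gauss_fun.
Qed.

Lemma integrable_poly_gaussian (R : realType) (p : {poly R}) :
  mu.-integrable setT (fun x => (p.[x] * gaussian x)%:E).
Proof.
have [K K0 pK] := poly_gaussian_bound p.
have gK : mu.-integrable setT (fun x : R => (K * gauss_fun (x / 2))%:E).
  have := @integrable_affine R (@gauss_fun R) 2 0
    (ltr0Sn R 1) (@continuous_gauss_fun R) integrableT_gauss.
  move=> /(integrableZl measurableT K).
  by apply: eq_integrable => // x _; rewrite subr0.
apply: le_integrable gK => //.
  apply/measurable_EFinP; apply: (@continuous_measurable_fun R).
  exact: continuous_poly_gaussian.
move=> x _; rewrite !abse_EFin lee_fin (le_trans (pK x))//.
exact: ler_norm.
Qed.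

(** By the fundamental theorem of calculus the integral over [[-n, n]] is a
    boundary term, and it tends to the integral over the line by dominated
    convergence.  Integer endpoints suffice for this. *)
Lemma integral_derivative_eq0 (R : realType) (f F : R -> R) :
  continuous f -> mu.-integrable setT (EFin \o f) ->
  (forall x : R, is_derive x (1 : R) F (f x)) ->
  F n%:R @[n --> \oo] --> 0 -> F (- n%:R) @[n --> \oo] --> 0 ->
  \int[mu]_x f x = 0.
Proof.
move=> cf intf dF Fy FNy.
have cF : continuous F.
  by move=> x; apply/differentiable_continuous/derivable1_diffP; case: (dF x).
pose D (n : nat) : set R := `[- n%:R, n%:R]%classic.
pose g (n : nat) := (EFin \o f) \_ (D n).
have mf : measurable_fun setT (EFin \o f) by exact: measurable_int intf.
have [] := @dominated_convergence _ _ R mu setT measurableT g (EFin \o f)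
  (fun x => `|(f x)%:E|%E).
- move=> n; apply/(measurable_restrictT _ _).1 => //; first exact: measurable_itv.
  exact: measurable_funTS.
- exact: mf.
- apply: aeW => x _; apply: cvg_near_cst; near=> n.
  rewrite /g patchE mem_set//= /D/= in_itv/= -ler_norml.
  by near: n; exact: nbhs_infty_ger.
- exact: integrable_abse.
- apply: aeW => x n _; rewrite /g patchE; case: ifPn => // _.
  by rewrite abse0 abse_ge0.
move=> _ _ cvg_int.
suff cvg0 : ([sequence \int[mu]_(x in setT) g n x]_n)%E @ \oo --> 0%E.
  by rewrite /Rintegral (cvg_unique _ cvg_int cvg0).
have : (F n%:R - F (- n%:R))%:E @[n --> \oo] --> 0%E.
  by apply/cvg_EFin; [exact: nearW|rewrite -(subr0 0); exact: cvgB].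
apply: cvg_trans; apply: near_eq_cvg; near=> n.
have n0 : 0 < n%:R :> R by rewrite ltr0n; near: n; exact: nbhs_infty_gt.
rewrite EFinB -(@continuous_FTC2 R f).
- by rewrite integral_mkcond.
- by rewrite (lt_trans _ n0)// oppr_lt0.
- exact: continuous_subspaceT.
- split=> [x _||]; first by case: (dF x).
    by apply: cvg_at_right_filter; exact: cF.
  by apply: cvg_at_left_filter; exact: cF.
- by move=> x _; rewrite derive1E; case: (dF x).
Unshelve. all: by end_near. Qed.

Lemma cvg_poly_gaussian (R : realType) (p : {poly R}) (x_ : R^nat) :
  `|x_ n| @[n --> \oo] --> +oo -> p.[x_ n] * gaussian (x_ n) @[n --> \oo] --> 0.
Proof.
move=> xy; have [K K0 pK] := poly_gaussian_bound p.
have : K * gauss_fun (`|x_ n| / 2) @[n --> \oo] --> 0.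
  rewrite -(mulr0 K); apply: cvgM; first exact: cvg_cst.
  apply: (cvg_comp (fun n => `|x_ n|) (fun y => gauss_fun (y / 2)) xy).
  apply: (cvg_comp (fun y : R => y / 2) (@gauss_fun R)); last exact: cvg_gauss_fun.
  by apply: gt0_cvgMly.
have gE n : gauss_fun (`|x_ n| / 2) = gauss_fun (x_ n / 2).
  by rewrite /gauss_fun !exprMn real_normK ?num_real.
move=> h; apply: (squeeze_cvgr _ _ h); last first.
  rewrite -oppr0; apply: cvgN; exact: h.
by apply: nearW => n; rewrite -ler_norml gE.
Qed.

Lemma is_derive_poly_gaussian (R : realType) (p : {poly R}) (x : R) :
  is_derive x (1 : R) (fun y => p.[y] * gaussian y)
    ((p^`() - 'X * p).[x] * gaussian x).
Proof.
have dg : is_derive x (1 : R) (fun y : R => - y ^+ 2 / 2) (- x).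
  have h := is_deriveZ (- 2^-1) (is_deriveX 2 (is_derive_id x (1 : R))).
  rewrite (_ : (fun y : R => _) = (- 2^-1) \*: (id ^+ 2)); last first.
    by apply/funext => y /=; rewrite /GRing.scale/= fctE; lra.
  by apply: (is_derive_eq h); rewrite /GRing.scale/= expr1; lra.
have de := @is_derive1_comp _ expR _ _ _ _ (is_derive_expR _) dg.
apply: is_derive_eq (is_deriveM (is_derive_poly p x) de) _.
by rewrite !hornerE /GRing.scale/= /gaussian; ring.
Qed.

(** Integration by parts: the two integrands differ by the derivative of
    [p.[x] * gaussian x], which decays at both ends. *)
Lemma Rintegral_deriv_poly_gaussian (R : realType) (p : {poly R}) :
  \int[mu]_x (p^`().[x] * gaussian x) = \int[mu]_x (('X * p).[x] * gaussian x).
Proof.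
apply/eqP; rewrite -subr_eq0 -RintegralB//; try exact: integrable_poly_gaussian.
under eq_Rintegral do rewrite -mulrBl -hornerN -hornerD.
apply/eqP; apply: integral_derivative_eq0 (is_derive_poly_gaussian p) _ _.
- exact: continuous_poly_gaussian.
- exact: integrable_poly_gaussian.
- apply: cvg_poly_gaussian; under eq_fun do rewrite ger0_norm//.
  exact: cvgr_idn.
- apply: cvg_poly_gaussian; under eq_fun do rewrite normrN ger0_norm//.
  exact: cvgr_idn.
Qed.

(** * Integrals of the Hermite functions *)

Definition gauss_moment {R : realType} (p : {poly R}) : R :=
  \int[mu]_x (p.[x] * gaussian x).

Lemma gauss_momentD (R : realType) (p q : {poly R}) :
  gauss_moment (p + q) = gauss_moment p + gauss_moment q.
Proof.
rewrite /gauss_moment -RintegralD//; try exact: integrable_poly_gaussian.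
by under eq_Rintegral do rewrite hornerD mulrDl.
Qed.

Lemma gauss_momentCM (R : realType) (c : R) (p : {poly R}) :
  gauss_moment (c%:P * p) = c * gauss_moment p.
Proof.
rewrite /gauss_moment -RintegralZl//; last exact: integrable_poly_gaussian.
by under eq_Rintegral do rewrite hornerCM -mulrA.
Qed.

(** The raising relation [H_(k+1) = 2 X H_k - H_k'].  The factors are constant
    polynomials so that [gauss_momentD] and [gauss_momentCM] apply as they are. *)
Lemma hermiteS_deriv (R : realType) k :
  hermite R k.+1 = 2%:P * ('X * hermite R k) + (-1)%:P * (hermite R k)^`().
Proof.
rewrite polyCN mulN1r mulrA.
case: k => [|k]; first by rewrite /= derivC mulr1 subr0.
by rewrite deriv_hermiteS hermiteSS.
Qed.

(** In the raising relation the term [2 X H_k] integrates, by parts, to twice the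
    integral of [H_k'], one copy of which is subtracted. *)
Lemma gauss_moment_hermiteS (R : realType) k :
  gauss_moment (hermite R k.+1) = gauss_moment (hermite R k)^`().
Proof.
rewrite hermiteS_deriv gauss_momentD !gauss_momentCM.
by rewrite [gauss_moment ('X * _)]/gauss_moment -Rintegral_deriv_poly_gaussian;
  rewrite -/(gauss_moment _); ring.
Qed.

Lemma gauss_moment_hermiteSS (R : realType) k :
  gauss_moment (hermite R k.+2) = 2 * k.+1%:R * gauss_moment (hermite R k).
Proof. by rewrite gauss_moment_hermiteS deriv_hermiteS gauss_momentCM. Qed.

Lemma gauss_moment_hermite1 (R : realType) : gauss_moment (hermite R 1) = 0.
Proof.
rewrite gauss_moment_hermiteS /= derivC -[0](mul0r 1) -[0 * 1]/(0%:P * 1).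
by rewrite polyC0 -polyC0 gauss_momentCM !mul0r.
Qed.

Lemma psiE (R : realType) n : @psi R n = fun x =>
  ((Num.sqrt (Num.sqrt pi * 2 ^+ n * n`!%:R))^-1%:P * hermite R n).[x]
  * gaussian x.
Proof. by apply/funext => x; rewrite hornerCM. Qed.

Lemma continuous_psi (R : realType) n : continuous (@psi R n).
Proof. by rewrite psiE; exact: continuous_poly_gaussian. Qed.

Lemma integrable_psi (R : realType) n :
  mu.-integrable setT (EFin \o @psi R n).
Proof. by rewrite psiE; exact: integrable_poly_gaussian. Qed.

Lemma psi_intE (R : realType) n : psi_int R n =
  (Num.sqrt (Num.sqrt pi * 2 ^+ n * n`!%:R))^-1 * gauss_moment (hermite R n).
Proof.
by rewrite -gauss_momentCM /psi_int psiE.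
Qed.

(** This says that [psi_n'] integrates to zero.  For [n = 0] the index [n.-1]
    is spurious but its factor is [sqrt 0], so that this case amounts to
    the vanishing of the integral of [psi_1]. *)
Lemma psi_int_rec (R : realType) n :
  Num.sqrt (n.+1%:R / 2) * psi_int R n.+1 = Num.sqrt (n%:R / 2) * psi_int R n.-1.
Proof.
case: n => [|n].
  by rewrite psi_intE gauss_moment_hermite1 mul0r sqrtr0 !mulr0 mul0r.
rewrite /= !psi_intE gauss_moment_hermiteSS.
set a : R := Num.sqrt pi * 2 ^+ n * n`!%:R.
have a0 : 0 < a by rewrite !mulr_gt0 ?sqrtr_gt0 ?pi_gt0 ?exprn_gt0 ?ltr0n ?fact_gt0.
have -> : Num.sqrt pi * 2 ^+ n.+2 * n.+2`!%:R = a * 2 ^+ 2 * n.+2%:R * n.+1%:R :> R.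
  by rewrite /a !factS !natrM !exprS; ring.
clearbody a; have s4 : Num.sqrt (2 ^+ 2) = 2 :> R by rewrite sqrtr_sqr ger0_norm.
have sn : n.+1%:R = Num.sqrt n.+1%:R ^+ 2 :> R by rewrite sqr_sqrtr.
rewrite [Num.sqrt (n.+2%:R / 2)]sqrtrM// [Num.sqrt (n.+1%:R / 2)]sqrtrM//.
rewrite (sqrtrM n.+1%:R) ?mulr_ge0 ?sqr_ge0 ?ltW//.
rewrite (sqrtrM n.+2%:R) ?mulr_ge0 ?sqr_ge0 ?ltW//.
rewrite (sqrtrM (2 ^+ 2)) ?ltW// s4 [X in 2 * X * _]sn.
have ne (x : R) : 0 < x -> Num.sqrt x != 0 by move=> x0; rewrite gt_eqF// sqrtr_gt0.
by field; rewrite !ne.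
Qed.

(** The recurrence with step two carries the value zero from index 1 to all odd
    indices. *)
Lemma psi_int_odd (R : realType) n : odd n -> psi_int R n = 0.
Proof.
rewrite -[n]odd_double_half => /[dup]; rewrite oddD odd_double addbF oddb => -> _.
elim: n./2 => [|k IH]; first by rewrite psi_intE gauss_moment_hermite1 mulr0.
have := psi_int_rec R (true + k.*2).+1; rewrite doubleS -/(addn _ _) IH mulr0.
by move/eqP; rewrite mulf_eq0 sqrtr_eq0 leNgt divr_gt0//= => /eqP.
Qed.

(** * Column sums of the finite difference matrix *)

(** The map [j |-> k - j] modulo [N] is an involution of the indices; [k + N - j]
    avoids truncation. *)
Lemma sum_ord_reflect (V : nmodType) (N k : nat) (f : nat -> V) : (k < N)%N ->
  \sum_(j < N) f ((k + N - j) %% N)%N = \sum_(j < N) f j.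
Proof.
move=> kN; have N0 : (0 < N)%N by exact: leq_ltn_trans kN.
pose h (j : 'I_N) : 'I_N := Ordinal (ltn_pmod (k + N - j) N0).
have hK : involutive h.
  move=> j; apply/val_inj => /=; have jN := ltn_ord j.
  have [kj|jk] := ltnP k j.
    have lt1 : (k + N - j < N)%N by rewrite -addnBA ?(ltnW jN)//; lia.
    by rewrite (modn_small lt1) subKn ?modn_small//; lia.
  have E : (k + N - j = (k - j) + N)%N by lia.
  rewrite E modnDr (modn_small (leq_ltn_trans (leq_subr _ _) kN)).
  have -> : (k + N - (k - j) = j + N)%N by lia.
  by rewrite modnDr modn_small.
by rewrite [RHS](reindex_inj (inv_inj hK)).
Qed.

(** The two nonzero ranges of the stencil, near [0] and near [N], are disjoint
    because [p < N], and reflection exchanges them with a change of sign. *)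
Lemma fd_coefN (R : realType) (N p : nat) (dx : R) (i : nat) :
  (p < N)%N -> (i < N)%N ->
  fd_coef N p dx ((N - i) %% N) = - fd_coef N p dx i.
Proof.
move=> pN iN.
have p2 : (p./2.*2 <= p)%N by rewrite -[leqRHS]odd_double_half leq_addl.
rewrite /fd_coef; have [->|i0] := posnP i.
  by rewrite subn0 modnn /= leqn0 subn_eq0 leqNgt (leq_ltn_trans _ pN) ?oppr0//; lia.
rewrite modn_small; last by lia.
rewrite subKn; last exact: ltnW.
case: ifP => h1; case: ifP => h2; try by lia.
- by rewrite ifT ?opprK//; lia.
- by rewrite ifT//; lia.
- by rewrite ifF ?ifF ?oppr0//; lia.
Qed.

(** A column lists the whole stencil in some order, and the stencil has sum zero
    because reflecting its indices changes the sign of the sum. *)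
Lemma fd_mx_col_sum (R : realType) (N p : nat) (dx : R) (k : 'I_N) :
  (p < N)%N -> \sum_j fd_mx N p dx j k = 0.
Proof.
move=> pN.
under eq_bigr do rewrite mxE.
rewrite (sum_ord_reflect (fd_coef N p dx)) ?ltn_ord//.
apply/eqP; rewrite -eqNr; apply/eqP.
have N0 : (0 < N)%N by exact: leq_ltn_trans pN.
rewrite -[RHS](sum_ord_reflect _ N0) -sumrN; apply: eq_bigr => j _.
by rewrite add0n fd_coefN ?ltn_ord.
Qed.

Lemma sum_fd_mx_mul (R : realType) (N p : nat) (dx : R) (v : 'cV[R]_N) :
  (p < N)%N -> \sum_j (fd_mx N p dx *m v) j 0 = 0.
Proof.
move=> pN.
under eq_bigr do rewrite mxE.
rewrite exchange_big big1// => k _.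
by rewrite -mulr_suml fd_mx_col_sum// mul0r.
Qed.

(** * Drift of the number of particles *)

(** With [r n = sqrt (n / 2)] and [I] the integrals of the Hermite functions, the
    summands are the contributions of the acceleration terms.  The
    coefficient of [c n] in the interior is [r n.+1 * I n.+1 - r n * I n.-1],
    zero by hypothesis; only the two upper boundary terms remain.  The value
    [n.-1 = 0] at [n = 0] is harmless since [r 0 = 0]. *)
Lemma telescope_three_term (R : comPzRingType) (r I c : nat -> R) (N : nat) :
  r 0%N = 0 -> (forall n, r n.+1 * I n.+1 = r n * I n.-1) ->
  \sum_(n < N.+1) I n * (r n * c n.-1 - r n.+1 * c n.+1)
  = - (r N * I N.-1 * c N) - r N.+1 * I N * c N.+1.
Proof.
move=> r0 rI; elim: N => [|N IH].
  by rewrite big_ord1/= r0 !mul0r sub0r oppr0 sub0r mulrN; ring.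
rewrite big_ord_recr /= IH.
have -> : I N.+1 * (r N.+1 * c N - r N.+2 * c N.+2) =
  r N.+1 * I N.+1 * c N - r N.+2 * I N.+1 * c N.+2 by ring.
by rewrite rI; ring.
Qed.

Section ParticleNumber.
Variables (R : realType) (S : finType) (Nv Nx p : nat) (ell : R).
Variables q u m alpha : S -> R.
Variable C : S -> 'I_Nv -> R -> 'cV[R]_Nx.
Variable E : R -> 'cV[R]_Nx.

Lemma Rintegral_f_sw (s : S) (j : 'I_Nx) (t : R) : 0 < alpha s ->
  \int[mu]_v f_sw u alpha C s j v t
  = \sum_(n < Nv) alpha s * psi_int R n * C s n t j 0.
Proof.
move=> alpha_gt0.
have int_psi n : mu.-integrable setT
    (fun v : R => (psi n ((v - u s) / alpha s))%:E).
  exact: integrable_affine _ alpha_gt0 (@continuous_psi R n) (integrable_psi R n).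
rewrite /Rintegral /f_sw; under eq_integral do rewrite -sumEFin.
rewrite integral_sum//; last first.
  by move=> n; under eq_fun do rewrite EFinM; exact: integrableZl.
rewrite (eq_bigr (fun n : 'I_Nv => (alpha s * psi_int R n * C s n t j 0)%:E)).
  by rewrite sumEFin.
move=> n _; under eq_integral do rewrite EFinM.
rewrite integralZl// (integral_affine (u s) alpha_gt0 (@continuous_psi R n)).
rewrite mulrC !EFinM /psi_int /Rintegral fineK//.
exact: integrable_fin_num (integrable_psi R n).
Qed.

Lemma particle_numberE (s : S) : 0 < alpha s ->
  particle_number ell u alpha C s = (fun t => spacing Nx ell *
    \sum_(n < Nv) alpha s * psi_int R n * \sum_(j < Nx) C s n t j 0).
Proof.
move=> alpha_gt0; apply/funext => t; rewrite /particle_number; congr (_ * _).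
under eq_bigr do rewrite Rintegral_f_sw//.
by rewrite exchange_big; apply: eq_bigr => n _; rewrite mulr_sumr.
Qed.

Lemma is_derive_particle_number (s : S) (t : R) (dC : 'I_Nv -> 'cV[R]_Nx) :
  0 < alpha s -> (forall n, is_derive t (1 : R) (C s n) (dC n)) ->
  is_derive t (1 : R) (particle_number ell u alpha C s) (spacing Nx ell *
    \sum_(n < Nv) alpha s * psi_int R n * \sum_(j < Nx) dC n j 0).
Proof.
move=> alpha_gt0 hC; rewrite particle_numberE//.
have dCij n j : is_derive t (1 : R) (fun t => C s n t j 0) (dC n j 0).
  have [der <-] := hC n; split; first exact: (derivable_mxP _ _ _).1 der j 0.
  by rewrite derive_mx// mxE.
rewrite (_ : (fun _ => _) = spacing Nx ell \*: (\sum_(n < Nv)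
  (alpha s * psi_int R n) \*: (\sum_(j < Nx) (fun t => C s n t j 0)))); last first.
  apply/funext => x; rewrite /= fct_sumE; congr (_ * _).
  by apply: eq_bigr => n _; rewrite /= fct_sumE.
by apply: is_deriveZ; apply: is_derive_sum => n.
Qed.

(** The product [E^T C_n] of the field with the coefficient vector of a mode; by
    the closure convention it is defined for every integer index. *)
Definition field_overlap (s : S) (n : int) (t : R) : R :=
  ((E t)^T *m coef C s n t) 0 0.

(** Summation over the grid removes the transport term, by [sum_fd_mx_mul]. *)
Lemma sum_sw_rhs (s : S) (n : nat) (t : R) : (p < Nx)%N ->
  \sum_j sw_rhs p ell q u m alpha C E s n t j 0 =
  q s / (m s * alpha s) * (Num.sqrt (n%:R / 2) * field_overlap s (n%:Z - 1) t
    - Num.sqrt (n.+1%:R / 2) * field_overlap s (n%:Z + 1) t).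
Proof.
move=> pNx; rewrite /sw_rhs; set w := (X in fd_mx _ _ _ *m X).
under eq_bigr do rewrite mxE [X in X + _]mxE.
rewrite big_split/= sumrN sum_fd_mx_mul// oppr0 add0r.
rewrite /field_overlap !mxE !mulr_sumr -sumrB mulr_sumr.
by apply: eq_bigr => j _; rewrite !mxE; ring.
Qed.

Lemma field_overlap_out (s : S) (t : R) : field_overlap s Nv%:Z t = 0.
Proof.
by rewrite /field_overlap /coef insubF ?ltnn// mulmx0 mxE.
Qed.
End ParticleNumber.

Lemma is_derive0_itv_cst (R : realType) (f : R -> R) (J : set R) :
  is_interval J -> (forall t, J t -> is_derive t (1 : R) f 0) ->
  forall t1 t2, J t1 -> J t2 -> f t1 = f t2.
Proof.
move=> iJ df t1 t2; wlog t12 : t1 t2 / t1 <= t2.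
  by move=> H J1 J2; case: (leP t1 t2) => [|/ltW] /H ->.
move=> J1 J2.
have Jt t : t1 <= t <= t2 -> J t by exact: iJ.
have [||c _] := @MVT_segment R f (cst 0) _ _ t12.
- by move=> t; rewrite in_itv/= => /andP[/ltW ? /ltW ?]; apply/df/Jt/andP.
- apply: derivable_within_continuous => t; rewrite in_itv/= => /Jt/df.
  by case.
by rewrite mul0r => /eqP; rewrite subr_eq0 => /eqP.
Qed.

Theorem theorem4 (R : realType) (S : finType) (Nv Nx p : nat) (ell : R)
    (q u m alpha : S -> R)
    (C : S -> 'I_Nv -> R -> 'cV[R]_Nx) (E : R -> 'cV[R]_Nx) (J : set R)
    (m_gt0 : forall s, 0 < m s) (alpha_gt0 : forall s, 0 < alpha s)
    (ell_gt0 : 0 < ell) (Nv_gt0 : (0 < Nv)%N)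
    (p_even : ~~ odd p) (p_gt0 : (0 < p)%N) (p_lt_Nx : (p < Nx)%N)
    (J_open : open J) (J_itv : is_interval J)
    (sol : sw_solution p ell q u m alpha C E J) (s : S) :
  (odd Nv -> forall t1 t2, J t1 -> J t2 ->
     particle_number ell u alpha C s t1 = particle_number ell u alpha C s t2)
  /\ (forall t, J t ->
     is_derive t 1 (particle_number ell u alpha C s)
       (if odd Nv then 0
        else - spacing Nx ell * (q s / m s) * Num.sqrt (Nv.-1%:R / 2)
             * psi_int R (Nv - 2)
             * ((E t)^T *m coef C s (Nv%:Z - 1) t) 0 0)).
Proof.
have rate t : J t -> is_derive t 1 (particle_number ell u alpha C s)
    (- spacing Nx ell * (q s / m s) * Num.sqrt (Nv.-1%:R / 2)
     * psi_int R (Nv - 2) * field_overlap C E s (Nv%:Z - 1) t).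
  move=> Jt.
  apply: is_derive_eq
    (is_derive_particle_number ell u (alpha_gt0 s) (fun n => sw_vlasov sol s n Jt)) _.
  under eq_bigr do rewrite sum_sw_rhs//.
  have out := field_overlap_out C E s t.
  case: Nv Nv_gt0 C out {sol} => // N _ C' out.
  pose e (n : nat) := field_overlap C' E s n t.
  have predz (n : nat) : n.+1%:Z - 1 = n by rewrite -addn1 PoszD addrK.
  have predE (n : nat) : field_overlap C' E s (n.+1%:Z - 1) t = e n.
    by rewrite predz.
  have ms : m s != 0 by rewrite gt_eqF.
  have als : alpha s != 0 by rewrite gt_eqF.
  rewrite (eq_bigr (fun n : 'I_N.+1 => (q s / m s) * (psi_int R n *
    (Num.sqrt (n%:R / 2) * e n.-1 - Num.sqrt (n.+1%:R / 2) * e n.+1)))).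
    rewrite -mulr_sumr (telescope_three_term (r := fun n => Num.sqrt (n%:R / 2))).
    - by rewrite predE subSS subn1 /e out; ring.
    - by rewrite mul0r sqrtr0.
    - exact: psi_int_rec.
  (* In mode 0 the index -1 of the system becomes [0.-1 = 0] in the telescoping sum;
     both terms carry the coefficient [sqrt 0]. *)
  move=> [[|n] /= _] _; last by rewrite predE -PoszD addn1 /e; field; rewrite ms.
  by rewrite mul0r sqrtr0 add0r /e; field; rewrite ms.
have drift t (Jt : J t) : is_derive t 1 (particle_number ell u alpha C s)
   (if odd Nv then 0
        else - spacing Nx ell * (q s / m s) * Num.sqrt (Nv.-1%:R / 2)
             * psi_int R (Nv - 2)
             * ((E t)^T *m coef C s (Nv%:Z - 1) t) 0 0).
  case: ifPn => oddNv; last exact: rate.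
  apply: is_derive_eq (rate t Jt) _.
  (* For [Nv = 1] the truncated index [Nv - 2] is 0, where the integral of the
     Hermite function is not zero. *)
  have [Nv1|Nv1] := eqVneq Nv 1%N.
    have -> : Num.sqrt (Nv.-1%:R / 2) = 0 :> R by rewrite Nv1 mul0r sqrtr0.
    by rewrite mulr0 !mul0r.
  rewrite psi_int_odd ?mulr0 ?mul0r// oddB ?oddNv//; lia.
by split=> // oddNv; apply: is_derive0_itv_cst => // t /drift; rewrite oddNv.
Qed.
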